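(* Let $\varphi$ be a self-map of $\mathbb{D}$. If $\|\varphi\|_\infty<1$ and $\varphi(0)\neq 0$, then $$\frac{1+|\varphi(0)|}{1-|\varphi(0)|}<\frac{\|\varphi\|_\infty+|\varphi(0)|}{\|\varphi\|_\infty-|\varphi(0)|}.$$
   Context: $\mathbb{D}=\{z\in\mathbb{C}:|z|<1\}$ is the open unit disc. A self-map of $\mathbb{D}$ means an analytic function $\varphi:\mathbb{D}\to\mathbb{D}$, and $\|\varphi\|_\infty=\sup_{z\in\mathbb{D}}|\varphi(z)|$. *)

(* Defs.v *)
From HB Require Import structures.
From mathcomp Require Import all_boot all_order all_algebra.
From mathcomp Require Import all_classical all_reals all_analysis.
From mathcomp Require Import complex.
Import Order.TTheory GRing.Theory Num.Theory.
Import numFieldNormedType.Exports.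

Set Implicit Arguments.
Unset Strict Implicit.
Unset Printing Implicit Defensive.

Local Open Scope classical_set_scope.
Local Open Scope ring_scope.

(* The norm [`|z|] of [R[i]] takes its values in [R[i]]; [modulus z] is the
   same number in [R], see [modulusE]. *)
Definition modulus (R : realType) (z : R[i]) : R := complex.Re `|z|.

Definition unit_disc (R : realType) : set R[i] := [set z | modulus z < 1].
Arguments unit_disc : clear implicits.

(* Complex differentiability at every point of [A] (used for open [A]): in
   [derivable f z 1] the increment [h] of the quotient
   [h^-1 *: (f (h + z) - f z)] ranges over the scalar field, which is [R[i]]
   because [f] is seen as a map of one-dimensional [R[i]]-normed modules. *)
Definition analytic_on (R : realType) (A : set R[i]) (f : R[i] -> R[i]) : Prop :=
  forall z, A z -> derivable (f : (R[i])^o -> (R[i])^o) z 1.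

(* Only the values of [phi] on the disc matter, see [self_map_ext] and
   [sup_norm_ext]. *)
Definition self_map (R : realType) (phi : R[i] -> R[i]) : Prop :=
  analytic_on (unit_disc R) phi /\
  (forall z, unit_disc R z -> unit_disc R (phi z)).

Definition sup_norm (R : realType) (phi : R[i] -> R[i]) : \bar R :=
  ereal_sup [set (modulus (phi z))%:E | z in unit_disc R].

Lemma modulusE (R : realType) (z : R[i]) : `|z| = (modulus z)%:C%C.
Proof. by rewrite /modulus normc_def. Qed.

Lemma unit_discE (R : realType) : unit_disc R = ball (0 : (R[i])^o) 1.
Proof.
apply/seteqP; split => z; rewrite /unit_disc -ball_normE /= sub0r normrN modulusE ltcR //.
Qed.

Lemma unit_disc0 (R : realType) : unit_disc R 0.
Proof. by rewrite /unit_disc /= /modulus normr0 ltr01. Qed.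

Lemma sup_norm_ext (R : realType) (phi psi : R[i] -> R[i]) :
  (forall z, unit_disc R z -> phi z = psi z) -> sup_norm phi = sup_norm psi.
Proof.
move=> e; congr ereal_sup; apply/seteqP.
by split => _ [z Dz <-]; exists z => //; rewrite e.
Qed.

Lemma self_map_ext (R : realType) (phi psi : R[i] -> R[i]) :
  (forall z, unit_disc R z -> phi z = psi z) -> self_map phi -> self_map psi.
Proof.
move=> e [ha hm]; split; last by move=> z Dz; rewrite -e //; exact: hm.
move=> z Dz.
have Dn : nbhs (z : (R[i])^o) (unit_disc R).
  rewrite unit_discE; apply: open_nbhs_nbhs; split; first exact: ball_open.
  by rewrite -unit_discE.
by apply: near_eq_derivable (ha z Dz); near=> w; apply: e; near: w.
Unshelve. all: by end_near. Qed.

(* Division by zero: a constant [phi] makes the denominator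
   [sup_norm phi - `|phi 0|] vanish, and the quotient is then [+oo]. *)
Lemma dive0 (R : realType) (x : \bar R) : (0 < x -> x / 0 = +oo)%E.
Proof. by move=> x0; rewrite inve0 gt0_muley. Qed.

Lemma dive_fin (R : realType) (x y : R) :
  y != 0 -> (x%:E / y%:E)%E = (x / y)%:E.
Proof. by move=> y0; rewrite inver (negbTE y0). Qed.

(* Main.v *)
Require Import Defs.
From mathcomp Require Import all_boot all_order all_algebra.
From mathcomp Require Import all_classical all_reals all_analysis.
From mathcomp Require Import complex.
From mathcomp Require Import lra.
Import Order.TTheory GRing.Theory Num.Theory.

Local Open Scope ring_scope.

(** Write [a] for the modulus of [phi 0] and [m] for the sup norm of [phi], so
    that [0 < a <= m < 1]; the bound [a <= m] holds because [0] is a point of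
    the disc. The map [t |-> (t + a) / (t - a)] is strictly decreasing on
    [t > a], being [1 + 2 a / (t - a)], and the claim compares its values at
    [1] and at [m] ([ltr_quotient_add_sub]). If [m = a], the right-hand side
    is [2 a / 0 = +oo] while the left-hand side is finite. *)

Lemma modulus_gt0 {R : realType} {z : R[i]} : z <> 0 -> 0 < modulus z.
Proof. by move=> /eqP z0; rewrite -ltcR -modulusE normr_gt0. Qed.

Lemma modulus_le_sup_norm {R : realType} (phi : R[i] -> R[i]) {z : R[i]} :
  unit_disc R z -> ((modulus (phi z))%:E <= sup_norm phi)%E.
Proof. by move=> Dz; apply: ereal_sup_ubound; exists z. Qed.

Lemma ltr_quotient_add_sub {R : realFieldType} {a s t : R} :
  0 < a -> a < s -> s < t -> (t + a) / (t - a) < (s + a) / (s - a).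
Proof.
move=> a0 as_ st; have at_ := lt_trans as_ st.
rewrite ltr_pdivrMr ?subr_gt0// mulrAC ltr_pdivlMr ?subr_gt0//.
(* The cross-multiplied difference is [2 * a * (t - s)]. *)
by nra.
Qed.

Theorem proposition6p1 (R : realType) (phi : R[i] -> R[i])
    (hphi : self_map phi)
    (hnorm : (sup_norm phi < 1)%E)
    (hphi0 : phi 0 <> 0) :
  ((1 + (modulus (phi 0))%:E) / (1 - (modulus (phi 0))%:E)
     < (sup_norm phi + (modulus (phi 0))%:E)
         / (sup_norm phi - (modulus (phi 0))%:E))%E.
Proof.
have a0 := modulus_gt0 hphi0.
have := modulus_le_sup_norm phi (unit_disc0 R).
move: hnorm a0; set a := modulus (phi 0).
case: (sup_norm phi) => [m| |] //; rewrite lte_fin lee_fin => m1 a0 am.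
have a1 : a < 1 := le_lt_trans am m1.
rewrite -EFinB -!EFinD dive_fin ?subr_eq0 ?gt_eqF//.
move: am; rewrite le_eqVlt => /predU1P[<-|am].
  by rewrite subrr dive0 ?ltry// lte_fin addr_gt0.
rewrite dive_fin ?subr_eq0 ?gt_eqF// lte_fin.
exact: ltr_quotient_add_sub.
Qed.
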